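(* Let $a$ and $b$ be positive real numbers. Then each of the four improper integrals $$\int_{0}^{\infty} x\sin(ax^2)\sin(bx)\,dx,\qquad \int_{0}^{\infty} x\cos(ax^2)\sin(bx)\,dx,$$ $$\int_{0}^{\infty} x\sin(ax^2)\cos(bx)\,dx,\qquad \int_{0}^{\infty} x\cos(ax^2)\cos(bx)\,dx$$ diverges.
   Context: For a continuous function $f:[0,\infty)\to\mathbb{R}$, the improper integral $\int_0^\infty f(x)\,dx$ is said to converge if $\lim_{T\to\infty}\int_0^T f(x)\,dx$ exists as a finite real number, and to diverge otherwise. *)

(* Defs.v *)
From Stdlib Require Import Reals.
From Coquelicot Require Import Coquelicot.
Open Scope R_scope.

(* Intended for functions continuous on [0, +oo); for those the total
   operator [RInt f 0 T] is the Riemann integral for every T >= 0. *)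
Definition improper_integral_converges (f : R -> R) : Prop :=
  ex_finite_lim (fun T : R => RInt f 0 T) p_infty.

Definition improper_integral_diverges (f : R -> R) : Prop :=
  ~ improper_integral_converges f.

(* Main.v *)
Require Import Defs.
From Stdlib Require Import Reals Lra.
From Coquelicot Require Import Coquelicot.
Open Scope R_scope.

(** Writing cosines as shifted sines, all four integrands have the form
    [x * sin (a * x ^ 2 + al) * sin (b * x + be)].  Since [a * x ^ 2] oscillates
    faster and faster while [b * x] moves at constant speed, arbitrarily far out
    some interval [[u, v]] on which [sin (b * x + be) >= 1/2] contains a full
    positive arch of [sin (a * x ^ 2 + al)].  The factor [x] makes the integral of
    [x * sin (a * x ^ 2 + al)] over such an arch equal to [1 / a], so the integral
    over [[u, v]] is at least [1 / (2 * a)] and the Cauchy criterion fails. *)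

(** The multiple is indexed by [nat], as [sin_period] and [cos_period] expect; this is why [t] must
    be nonnegative. *)
Lemma next_period (t : R) : 0 <= t ->
  exists n : nat, t <= 2 * INR n * PI <= t + 2 * PI.
Proof.
  intros ht.
  assert (hpi := PI_RGT_0).
  destruct (nfloor_ex (t / (2 * PI))) as [n [h1 h2]].
  { apply Rdiv_le_0_compat; lra. }
  exists (S n). rewrite S_INR.
  replace t with (t / (2 * PI) * (2 * PI)) by (field; lra).
  split; nra.
Qed.

Lemma sin_ge_half (x : R) : PI / 6 <= x <= 5 * PI / 6 -> 1 / 2 <= sin x.
Proof.
  intros hx. assert (hpi := PI_RGT_0). rewrite <- sin_PI6.
  destruct (Rle_dec x (PI / 2)).
  - apply sin_incr_1; lra.
  - rewrite <- (sin_PI_x x). apply sin_incr_1; lra.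
Qed.

Lemma is_RInt_mul_sin_sqr (a al u v : R) : a <> 0 ->
  is_RInt (fun x => x * sin (a * x ^ 2 + al)) u v
    ((cos (a * u ^ 2 + al) - cos (a * v ^ 2 + al)) / (2 * a)).
Proof.
  intros ha.
  replace ((cos (a * u ^ 2 + al) - cos (a * v ^ 2 + al)) / (2 * a))
    with (minus (- cos (a * v ^ 2 + al) / (2 * a)) (- cos (a * u ^ 2 + al) / (2 * a)))
    by (unfold minus, plus, opp; simpl; field; exact ha).
  apply (is_RInt_derive (fun x => - cos (a * x ^ 2 + al) / (2 * a))).
  - intros x _. auto_derive; [exact I | simpl; field; exact ha].
  - intros x _. apply (ex_derive_continuous (V := R_NormedModule)).
    auto_derive; exact I.
Qed.

Lemma ex_RInt_mul_sin_sqr_mul_sin (a b al be u v : R) :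
  ex_RInt (fun x => x * sin (a * x ^ 2 + al) * sin (b * x + be)) u v.
Proof.
  apply (ex_RInt_continuous (V := R_CompleteNormedModule)). intros x _.
  apply (ex_derive_continuous (V := R_NormedModule)). auto_derive; exact I.
Qed.

(** Find a far window [[p, p + L]] on which [b * x + be] runs from [PI / 6] to [5 * PI / 6] modulo
    [2 * PI]. There [a * x ^ 2] gains at least [4 * PI]: up to [2 * PI] to reach a full period, then
    [PI] for the arch. *)
Lemma exists_positive_arch (a b al be M : R) : 0 < a -> 0 < b ->
  exists (u v : R) (n : nat), M <= u /\ 0 <= u <= v /\
    a * u ^ 2 + al = 2 * INR n * PI /\ a * v ^ 2 + al = 2 * INR n * PI + PI /\
    forall x, u <= x <= v -> 1 / 2 <= sin (b * x + be).
Proof.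
  intros ha hb. assert (hpi := PI_RGT_0).
  (* The term [3 * b / a] makes [a * x ^ 2] increase by at least [4 * PI] over
     an interval of length [2 * PI / (3 * b)] lying beyond [P]. *)
  set (P := 1 + Rabs M + 3 * b / a + Rabs be / b + Rabs al / a).
  assert (h3 : 0 < 3 * b / a) by (apply Rdiv_lt_0_compat; lra).
  assert (h4 : 0 <= Rabs be / b) by (apply Rdiv_le_0_compat; [apply Rabs_pos | lra]).
  assert (h5 : 0 <= Rabs al / a) by (apply Rdiv_le_0_compat; [apply Rabs_pos | lra]).
  assert (h6 := Rabs_pos M). assert (h7 := Rle_abs M).
  assert (h8 := Rle_abs (- be)). rewrite Rabs_Ropp in h8.
  assert (h9 := Rle_abs (- al)). rewrite Rabs_Ropp in h9.
  assert (hP : 1 <= P) by (unfold P; lra).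
  assert (hPM : M <= P) by (unfold P; lra).
  assert (hPa : 3 * b <= a * P).
  { replace (3 * b) with (a * (3 * b / a)) by (field; lra).
    apply Rmult_le_compat_l; unfold P; lra. }
  (* [hPb] and [hPl] keep the phases [b * P + be] and [a * p ^ 2 + al] nonnegative, as [next_period]
     demands; the latter also uses [P <= p ^ 2]. *)
  assert (hPb : - be <= b * P).
  { apply Rle_trans with (1 := h8).
    replace (Rabs be) with (b * (Rabs be / b)) at 1 by (field; lra).
    apply Rmult_le_compat_l; unfold P; lra. }
  assert (hPl : - al <= a * P).
  { apply Rle_trans with (1 := h9).
    replace (Rabs al) with (a * (Rabs al / a)) at 1 by (field; lra).
    apply Rmult_le_compat_l; unfold P; lra. }
  clearbody P.
  destruct (next_period (b * P + be)) as [k [hk _]]; [lra |].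
  set (p := (2 * INR k * PI + PI / 6 - be) / b).
  assert (hp : b * p + be = 2 * INR k * PI + PI / 6) by (unfold p; field; lra).
  clearbody p.
  assert (hPp : P <= p) by nra.
  destruct (next_period (a * p ^ 2 + al)) as [n [hn1 hn2]].
  { assert (P <= p ^ 2) by nra.
    assert (a * P <= a * p ^ 2) by (apply Rmult_le_compat_l; lra). lra. }
  set (L := 2 * PI / (3 * b)).
  assert (hL : b * L = 2 * PI / 3) by (unfold L; field; lra).
  assert (hL0 : 0 < L) by (unfold L; apply Rdiv_lt_0_compat; lra).
  clearbody L.
  (* The increase is [2 * a * p * L + a * L ^ 2], at least [6 * b * L = 4 * PI]. *)
  assert (hgrow : a * p ^ 2 + 4 * PI <= a * (p + L) ^ 2).
  { assert (3 * b <= a * p) by nra.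
    assert (3 * b * L <= a * p * L) by (apply Rmult_le_compat_r; lra).
    assert (0 <= a * L ^ 2) by (apply Rmult_le_pos; [lra | apply pow2_ge_0]).
    lra. }
  assert (root : forall s, a * p ^ 2 <= s -> s <= a * (p + L) ^ 2 ->
            exists w, p <= w <= p + L /\ a * w ^ 2 = s).
  { intros s hs1 hs2.
    assert (hs : a * (s / a) = s) by (field; lra).
    assert (0 <= s / a) by (apply Rdiv_le_0_compat; nra).
    exists (sqrt (s / a)). rewrite pow2_sqrt by assumption.
    split; [split | exact hs].
    - rewrite <- (sqrt_pow2 p) by lra. apply sqrt_le_1_alt.
      apply Rmult_le_reg_l with a; lra.
    - rewrite <- (sqrt_pow2 (p + L)) by lra. apply sqrt_le_1_alt.
      apply Rmult_le_reg_l with a; lra. }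
  (* By [hn1] and [hn2] both targets lie between [a * p ^ 2] and [a * p ^ 2 + 3 * PI], within the
     range of [root]. *)
  destruct (root (2 * INR n * PI - al)) as [u [hu1 hu2]]; [lra | lra |].
  destruct (root (2 * INR n * PI + PI - al)) as [v [hv1 hv2]]; [lra | lra |].
  exists u, v, n. repeat split; try lra.
  - apply Rnot_lt_le. intros hvu.
    assert (v ^ 2 <= u ^ 2) by (apply pow_incr; lra).
    assert (a * v ^ 2 <= a * u ^ 2) by (apply Rmult_le_compat_l; lra).
    lra.
  - intros x hx.
    replace (b * x + be) with (b * x + be - 2 * INR k * PI + 2 * INR k * PI) by ring.
    rewrite sin_period. apply sin_ge_half.
    assert (b * p <= b * x) by (apply Rmult_le_compat_l; lra).
    assert (b * x <= b * (p + L)) by (apply Rmult_le_compat_l; lra).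
    lra.
Qed.

Lemma improper_integral_diverges_ext (f g : R -> R) :
  (forall x, f x = g x) -> improper_integral_diverges f -> improper_integral_diverges g.
Proof.
  intros hfg hf [l hl]. apply hf. exists l.
  apply is_lim_ext with (2 := hl). intros T. symmetry.
  apply (RInt_ext (V := R_CompleteNormedModule)). intros x _. apply hfg.
Qed.

Lemma mul_sin_sqr_mul_sin_diverges (a b al be : R) : 0 < a -> 0 < b ->
  improper_integral_diverges (fun x => x * sin (a * x ^ 2 + al) * sin (b * x + be)).
Proof.
  intros ha hb.
  set (f := fun x => x * sin (a * x ^ 2 + al) * sin (b * x + be)).
  intros [l hl]. assert (hpi := PI_RGT_0).
  (* Two partial integrals within [1 / (4 * a)] of [l] differ by less than [1 / (2 * a)], the lower
     bound for the integral over an arch. *)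
  assert (he : 0 < 1 / (4 * a)) by (apply Rdiv_lt_0_compat; lra).
  apply is_lim_spec in hl.
  destruct (hl (mkposreal _ he)) as [M hM]. simpl in hM.
  (* [hM] needs arguments strictly above [M], hence [M + 1]. *)
  destruct (exists_positive_arch a b al be (M + 1) ha hb)
    as (u & v & n & hMu & huv & hu & hv & hb2).
  assert (h1 := hM u ltac:(lra)). assert (h2 := hM v ltac:(lra)).
  assert (hf : forall s t, ex_RInt f s t) by (intros; apply ex_RInt_mul_sin_sqr_mul_sin).
  assert (hC := RInt_Chasles f 0 u v (hf _ _) (hf _ _)).
  unfold plus in hC; simpl in hC.
  assert (hg := is_RInt_mul_sin_sqr a al u v ltac:(lra)).
  rewrite hu, hv, neg_cos in hg.
  replace (2 * INR n * PI) with (0 + 2 * INR n * PI) in hg by ring.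
  rewrite cos_period, cos_0 in hg.
  (* Half of the arch, the minorant of [f] given by the bound [1 / 2] on the second sine, integrates
     to [1 / (2 * a)]. *)
  apply (is_RInt_scal _ _ _ (1 / 2)) in hg.
  assert (hle : (forall x, u < x < v -> 1 / 2 * (x * sin (a * x ^ 2 + al)) <= f x) ->
      1 / 2 * ((1 - -1) / (2 * a)) <= RInt f u v)
    by exact (is_RInt_le _ f u v _ _ (proj2 huv) hg (RInt_correct f u v (hf u v))).
  replace (1 / 2 * ((1 - -1) / (2 * a))) with (2 * (1 / (4 * a))) in hle
    by (field; lra).
  apply Rabs_def2 in h1. apply Rabs_def2 in h2.
  enough (2 * (1 / (4 * a)) <= RInt f u v) by lra.
  apply hle. intros x hx. unfold f.
  assert (hs : 0 <= sin (a * x ^ 2 + al)).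
  { replace (a * x ^ 2 + al) with (a * x ^ 2 + al - 2 * INR n * PI + 2 * INR n * PI)
      by ring.
    rewrite sin_period.
    assert (u ^ 2 <= x ^ 2) by (apply pow_incr; lra).
    assert (x ^ 2 <= v ^ 2) by (apply pow_incr; lra).
    assert (a * u ^ 2 <= a * x ^ 2) by (apply Rmult_le_compat_l; lra).
    assert (a * x ^ 2 <= a * v ^ 2) by (apply Rmult_le_compat_l; lra).
    apply sin_ge_0; lra. }
  assert (hsb := hb2 x ltac:(lra)).
  rewrite Rmult_comm. apply Rmult_le_compat_l; [apply Rmult_le_pos; lra | exact hsb].
Qed.

Theorem mainTheorem1 (a b : R) (ha : 0 < a) (hb : 0 < b) :
  improper_integral_diverges (fun x : R => x * sin (a * x ^ 2) * sin (b * x)) /\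
  improper_integral_diverges (fun x : R => x * cos (a * x ^ 2) * sin (b * x)) /\
  improper_integral_diverges (fun x : R => x * sin (a * x ^ 2) * cos (b * x)) /\
  improper_integral_diverges (fun x : R => x * cos (a * x ^ 2) * cos (b * x)).
Proof.
  assert (hD := fun al be => mul_sin_sqr_mul_sin_diverges a b al be ha hb).
  repeat split.
  - apply improper_integral_diverges_ext with (2 := hD 0 0).
    intros x. now rewrite !Rplus_0_r.
  - apply improper_integral_diverges_ext with (2 := hD (PI / 2) 0).
    intros x. now rewrite !Rplus_0_r, (cos_sin (a * x ^ 2)), (Rplus_comm (PI / 2)).
  - apply improper_integral_diverges_ext with (2 := hD 0 (PI / 2)).
    intros x. now rewrite !Rplus_0_r, (cos_sin (b * x)), (Rplus_comm (PI / 2)).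
  - apply improper_integral_diverges_ext with (2 := hD (PI / 2) (PI / 2)).
    intros x. now rewrite !cos_sin, !(Rplus_comm (PI / 2)).
Qed.
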